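(* A circulant graph $X=\operatorname{Cay}(\mathbb{Z}_n,S)$ of valency $5$ is unstable if and only if either it is trivially unstable, or it is one of the following: (1) $\operatorname{Cay}(\mathbb{Z}_{12k},\{\pm s,\pm 2k,6k\})$ for some positive integer $k$ and odd integer $s$, which has Wilson type (C.1); (2) $\operatorname{Cay}(\mathbb{Z}_8,\{\pm1,\pm3,4\})$, which has Wilson type (C.3$'$).
   Context: All graphs are finite, undirected and simple. $\operatorname{Cay}(\mathbb{Z}_n,S)$ (with $S\subseteq\mathbb{Z}_n\setminus\{0\}$, $S=-S$) has vertex set $\mathbb{Z}_n$ and $v\sim w$ iff $w-v\in S$; its valency is $|S|$ (so in (1) the five listed elements are distinct). The canonical bipartite double cover $BX$ has vertex set $V(X)\times\{0,1\}$, with $(v,0)\sim(w,1)$ iff $v\sim w$ in $X$. $X$ is unstable if $\operatorname{Aut}BX\neq\operatorname{Aut}X\times S_2$. A graph is twin-free if no two distinct vertices have the same neighbourhood. $X$ is nontrivially unstable if connected, nonbipartite, twin-free and unstable; trivially unstable if unstable but not nontrivially unstable. Wilson types (for $n$ even, $S_e=S\cap2\mathbb{Z}_n$, $S_o=S\setminus S_e$): (C.1) there is a nonzero $h\in 2\mathbb{Z}_n$ with $h+S_e=S_e$. (C.3$'$) there is a subgroup $H$ of $\mathbb{Z}_n$ such that $R=\{s\in S: s+H\not\subseteq S\}$ is nonempty and, with $d=\gcd(R\cup\{n\})$, $n/d$ is even, $r/d$ is odd for all $r\in R$, and either $H\not\subseteq d\mathbb{Z}_n$ or $H\subseteq 2d\mathbb{Z}_n$.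 *)

(* Defs.v *)
From mathcomp Require Import all_boot all_order all_algebra all_fingroup.

Set Implicit Arguments.
Unset Strict Implicit.
Unset Printing Implicit Defensive.

Import GRing.Theory.
Local Open Scope ring_scope.

(* A graph is given by its adjacency relation [e : rel T] on a finite type;   *)
(* the Cayley graphs below are symmetric and irreflexive as soon as           *)
(* [S = -S] and [0 \notin S].                                                 *)

Section Graphs.
Variables (T : finType) (e : rel T).

Definition graph_aut : {set {perm T}} :=
  [set p : {perm T} | [forall x, forall y, e (p x) (p y) == e x y]].

Definition graph_connected : Prop := forall x y, connect e x y.

Definition graph_bipartite : Prop :=
  exists c : T -> bool, forall x y, e x y -> c x != c y.

Definition twin_free : Prop := forall x y, e x =1 e y -> x = y.

(* Canonical bipartite double cover; [false] and [true] are the layers 0, 1.  *)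
Definition double_cover : rel (T * bool) :=
  [rel x y | (x.2 != y.2) && e x.1 y.1].

End Graphs.

Lemma prod_perm_inj (T1 T2 : finType) (a : {perm T1}) (b : {perm T2}) :
  injective (fun x : T1 * T2 => (a x.1, b x.2)).
Proof. by move=> [x1 x2] [y1 y2] [] /perm_inj -> /perm_inj ->. Qed.

Definition prod_perm (T1 T2 : finType) (a : {perm T1}) (b : {perm T2}) :
  {perm T1 * T2} := perm (@prod_perm_inj T1 T2 a b).

Section Stability.
Variables (T : finType) (e : rel T).

(* Aut X x S_2, as a set of permutations of the vertices of BX.               *)
Definition aut_times_S2 : {set {perm T * bool}} :=
  [set prod_perm a b | a in graph_aut e, b in [set: {perm bool}]].

Definition unstable : Prop := graph_aut (double_cover e) <> aut_times_S2.

Definition nontrivially_unstable : Prop :=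
  [/\ graph_connected e, ~ graph_bipartite e, twin_free e & unstable].

Definition trivially_unstable : Prop := unstable /\ ~ nontrivially_unstable.

End Stability.

(* ['Z_n] is the ring of integers modulo n only when [1 < n]; everything      *)
(* below is meant under that condition.                                       *)
Section Circulant.
Variable n : nat.
Implicit Type S : {set 'Z_n}.

Definition cay S : rel 'Z_n := [rel v w | w - v \in S].

(* The subgroup dZ_n.                                                         *)
Definition multiples (d : nat) : {set 'Z_n} := [set x *+ d | x : 'Z_n].

Definition translate (x : 'Z_n) (A : {set 'Z_n}) : {set 'Z_n} :=
  [set x + a | a in A].

Definition wilson_C1 S : Prop :=
  let Se := S :&: multiples 2 in
  ~~ odd n /\
  exists h : 'Z_n, [/\ h != 0, h \in multiples 2 & translate h Se = Se].

Definition gcd_with_n (A : {set 'Z_n}) : nat :=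
  gcdn (\big[gcdn/0%N]_(r in A) (r : nat)) n.

(* [{group 'Z_n}] refers to the additive group structure of ['Z_n].           *)
Definition wilson_C3' S : Prop :=
  ~~ odd n /\
  exists H : {group 'Z_n},
    let R := [set s in S | ~~ (translate s H \subset S)] in
    let d := gcd_with_n R in
    [/\ R != set0,
        ~~ odd (n %/ d),
        forall r : 'Z_n, r \in R -> odd (r %/ d)
      & ~~ (H \subset multiples d) \/ H \subset multiples (2 * d)].

Definition family_12k S : Prop :=
  exists (k : nat) (s : int),
    [/\ (0 < k)%N, ~~ (2 %| s)%Z, n = (12 * k)%N
      & S = [set s%:~R; - s%:~R; (2 * k)%:R; - (2 * k)%:R; (6 * k)%:R]].

Definition exceptional_8 S : Prop :=
  n = 8%N /\ S = [set 1; - 1; 3%:R; - 3%:R; 4%:R].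

End Circulant.

(* Main.v *)
Require Import Defs.
From mathcomp Require Import all_boot all_order all_algebra all_fingroup.
From mathcomp Require Import ring zify.

Set Implicit Arguments.
Unset Strict Implicit.
Unset Printing Implicit Defensive.

Import GRing.Theory.
Local Open Scope ring_scope.

(* Valency 5 forces n = 2m and S = {a, -a, b, -b, h} with h = m. When X is    *)
(* connected and nonbipartite, an unexpected automorphism of BX is a pair     *)
(* (phi false, phi true) of permutations of Z_n acting on the two layers with *)
(* phi false 0 = 0 and phi true 0 <> 0. Such a pair preserves the number of   *)
(* walks of each length between vertices. Walks of length 2 and 3 are         *)
(* governed by the relations of length four among a, b and h. Two independent *)
(* relations bound m by their determinant, which leaves finitely many graphs, *)
(* checked by counting walks of length 5, except for the one on Z_8 in the    *)
(* statement. With no relation, or with a single one (up to symmetry 4a = 0,  *)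
(* b = 3a, 2a = 2b, 3a = h or b = 2a + h), the numbers of walks of length 3   *)
(* tell apart enough edge classes to force phi true 0 = 0, except when 3a = h *)
(* with m even: this is the family with n = 12k.                              *)

(** In a connected nonbipartite graph, every automorphism of the double cover keeps or exchanges the
    two layers, so instability means that some pair of permutations as above differs at a vertex
    ([twofold_unstable], [unstable_twofold]); translating makes that vertex 0. By [walks_phi], such
    a pair only mixes generators joined to 0 by equally many walks of length 3. If it preserves {a,
    -a} and {b, -b}, lines in these directions go to lines. By parity, one of these lines, followed
    by an edge h when m is even, leads from 0 to 0 in the other layer; hence [fixes_all]. The
    remaining single-relation cases use short walks, and [case_generic] shows that the pair is
    affine. [rel_det_dvd] and [small_okT] dispose of several relations.

    Conversely, in the family the even part {2k, 6k, 10k} of S is a coset of the subgroup of order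
    3, which gives (C.1) and hence instability ([family_12k_C1], [wilson_C1_unstable]). The graph on
    Z_8 is the complete bipartite graph between even and odd residues plus the perfect matching x, x
    + 4; two cover edges above the matching can be exchanged ([exceptional_8_unstable]). *)

Section TwoFold.
Variables (T : finType) (e : rel T).

Definition twofold (phi : bool -> T -> T) : Prop :=
  (forall i, injective (phi i)) /\
  (forall i x y, e (phi i x) (phi (~~ i) y) = e x y).

Lemma connected_invariant (P : T -> Prop) x :
  graph_connected e -> (forall y z, e y z -> P y -> P z) -> P x ->
  forall y, P y.
Proof.
move=> conn Pe Px y; have /connectP[p ep ->] := conn x y.
elim: p x Px ep => //= z p IH x Px /andP[exz /(IH z)]; apply.
exact: Pe exz Px.
Qed.

(** Along a walk from [x0] the values of F and G are kept or swapped according to the parity of its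
    length; if they differed at [x0], the value of F would be a proper 2-colouring. *)
Lemma alternating_const (C : eqType) (F G : T -> C) :
  graph_connected e -> ~ graph_bipartite e ->
  (forall x y, e x y -> F y = G x /\ G y = F x) -> F =1 G.
Proof.
move=> conn nbip FG x0.
have FGx0 x : (F x = F x0 /\ G x = G x0) \/ (F x = G x0 /\ G x = F x0).
  move: x; apply: (@connected_invariant _ x0) => // [y z /FG[-> ->]|].
    by case=> -[-> ->]; [right|left].
  by left.
have [//|neqFG] := eqVneq (F x0) (G x0).
case: nbip; exists (fun x => F x == F x0) => x y /FG[-> _].
by case: (FGx0 x) => -[-> ->]; rewrite eqxx (eq_sym (G x0)) (negPf neqFG).
Qed.

Lemma aut_times_S2_sub : aut_times_S2 e \subset graph_aut (double_cover e).
Proof.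
apply/subsetP => p /imset2P[a b]; rewrite inE => /forallP aP _ ->.
rewrite inE; apply/forallP => x; apply/forallP => y.
rewrite /double_cover !permE /= (inj_eq perm_inj).
by have /forallP/(_ y.1)/eqP-> := aP x.1.
Qed.

(** The pair acts on the cover layer by layer, whereas an element of [aut_times_S2] uses one
    permutation for both layers. *)
Lemma twofold_unstable phi v :
  twofold phi -> phi false v <> phi true v -> unstable e.
Proof.
move=> [phi_inj phiE] neq autE; apply: neq.
have f_inj : injective (fun x : T * bool => (phi x.2 x.1, x.2)).
  by move=> [x i] [y j] /= [+ eqij]; rewrite eqij => /phi_inj ->.
have: perm f_inj \in graph_aut (double_cover e).
  rewrite inE; apply/forallP => -[x i]; apply/forallP => -[y j].
  by rewrite /double_cover !permE; case: i j => [] [] //=; rewrite phiE.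
rewrite autE => /imset2P[a b _ _ fE].
have fx i : phi i v = a v.
  by have /(congr1 (fun p : {perm _} => (p (v, i)).1)) := fE; rewrite !permE.
by rewrite !fx.
Qed.

Lemma unstable_twofold :
  graph_connected e -> ~ graph_bipartite e -> symmetric e -> unstable e ->
  exists phi, twofold phi /\ exists v, phi false v <> phi true v.
Proof.
move=> conn nbip e_sym unst.
have [p p_aut pN] : exists2 p, p \in graph_aut (double_cover e) &
    p \notin aut_times_S2 e.
  apply/subsetPn/negP => sub; apply: unst; apply/eqP.
  by rewrite eqEsubset sub aut_times_S2_sub.
have pE x y : double_cover e (p x) (p y) = double_cover e x y.
  by move: p_aut; rewrite inE => /forallP/(_ x)/forallP/(_ y)/eqP.
have layer i x y : e x y -> (p (y, ~~ i)).2 = ~~ (p (x, i)).2.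
  move=> exy; have := pE (x, i) (y, ~~ i).
  rewrite /double_cover /= exy andbT; case: i => /= /andP[].
    by case: (p _).2; case: (p _).2.
  by case: (p _).2; case: (p _).2.
(* This is where nonbipartiteness enters: the layer of an image depends only on the layer of the
   vertex. *)
have layer_swap : (fun x => (p (x, false)).2) =1 (fun x => ~~ (p (x, true)).2).
  apply: alternating_const => // x y exy.
  by rewrite (layer true x y exy) (layer false x y exy) negbK.
have [x0|Tempty] := pickP (@predT T); last first.
  case: nbip; exists (fun _ => true) => x; by have := Tempty x.
move=> _; set c := (p (x0, false)).2.
have layerE x i : (p (x, i)).2 = c (+) i.
  have p0 : forall x, (p (x, false)).2 = c.
    apply: (@connected_invariant _ x0) => // y z eyz <-.
    by rewrite layer_swap (layer false y z eyz) negbK.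
  case: i; last by rewrite p0 addbF.
  by rewrite -[LHS]negbK -layer_swap p0 addbT.
pose phi i x := (p (x, i)).1.
exists phi; split.
  split=> [i x y|i x y]; rewrite /phi.
    move=> eq1; have : p (x, i) = p (y, i).
      by rewrite [LHS]surjective_pairing [RHS]surjective_pairing eq1 !layerE.
    by move/perm_inj => [].
  have := pE (x, i) (y, ~~ i).
  by rewrite /double_cover /= !layerE; case: i; case: (c).
have [/existsP[v /eqP]|/existsPn phi_eq] := boolP [exists v, phi false v != phi true v].
  by exists v.
case/negP: pN.
have phiF i x : phi i x = phi false x.
  by case: i => //; have := phi_eq x; rewrite negbK => /eqP.
have a_inj : injective (phi false).
  move=> x y; rewrite /phi => eq1; have : p (x, false) = p (y, false).
    by rewrite [LHS]surjective_pairing [RHS]surjective_pairing eq1 !layerE.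
  by move/perm_inj => [].
have b_inj : injective (addb c) by apply: addbI.
apply/imset2P; exists (perm a_inj) (perm b_inj); rewrite ?inE //.
  apply/forallP => x; apply/forallP => y; rewrite !permE.
  have := pE (x, false) (y, true).
  rewrite /double_cover /= !layerE -/(phi false x) -/(phi true y) phiF.
  by case: (c) => /= ->.
apply/permP => -[x i]; rewrite !permE /= -(phiF i) -(layerE x i).
exact: surjective_pairing.
Qed.

End TwoFold.

(** * Invariance of walk counts *)

Section Walks.
Variables (n : nat) (sl : seq 'Z_n).

Fixpoint walks (k : nat) (d : 'Z_n) : nat :=
  if k is k'.+1 then \sum_(u <- sl) walks k' (d - u)%R else d == 0%R.

Variables (S : {set 'Z_n}) (phi : bool -> 'Z_n -> 'Z_n).
Hypotheses (sl_uniq : uniq sl) (S_sl : S =i sl).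
Hypothesis phi_twofold : twofold (cay S) phi.

Lemma walksS k x y :
  (walks k.+1 (y - x)%R = \sum_(z | (y - z)%R \in S) walks k (z - x)%R)%N.
Proof.
rewrite /= [LHS]big_uniq //= (reindex_inj (inv_inj (subKr y))) /=.
apply: eq_big => z; first by rewrite S_sl.
by move=> _; congr walks; ring.
Qed.

(** The pair maps walks of the double cover bijectively to walks; one of length k starting in layer
    i ends in layer [i (+) odd k]. *)
Lemma walks_phi k i x y :
  walks k (phi (i (+) odd k) y - phi i x) = walks k (y - x).
Proof.
have [phi_inj phi_adj] := phi_twofold.
elim: k y => [|k IH] y; first by rewrite /= addbF !subr_eq0 (inj_eq (@phi_inj i)).
rewrite !walksS (reindex_inj (@phi_inj (i (+) odd k))) /=.
apply: eq_big => z; last by move=> _; apply: IH.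
by rewrite addbN; exact: phi_adj.
Qed.

End Walks.

Definition cyc_sub (n d t : nat) : nat :=
  if (t <= d)%N then (d - t)%N else (n + d - t)%N.

(** A copy of [walks] on natural numbers that [vm_compute] can evaluate. *)
Fixpoint nat_walks (n : nat) (sl : seq nat) (k d : nat) : nat :=
  if k is k'.+1 then sumn [seq nat_walks n sl k' (cyc_sub n d u) | u <- sl]
  else d == 0%N.

Section Residues.
Variable n : nat.
Hypothesis n_gt1 : (1 < n)%N.

Lemma ltn_Zn (x : 'Z_n) : (x < n)%N.
Proof. by rewrite -[X in (_ < X)%N](Zp_cast n_gt1). Qed.

Lemma val_subZ (d t : 'Z_n) : (d - t)%R = cyc_sub n d t :> nat.
Proof.
have := ltn_Zn d; have := ltn_Zn t.
rewrite /= /cyc_sub; move: (d : nat) (t : nat) => {}d {}t tn dn.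
rewrite (Zp_cast n_gt1) modnDmr.
have [td|dt] := leqP t d.
  by rewrite addnBA ?(ltnW tn) // addnC -addnBA // modnDl modn_small //; lia.
by rewrite modn_small; lia.
Qed.

Lemma nat_walksE (sl : seq 'Z_n) k d :
  walks sl k d = nat_walks n [seq nat_of_ord u | u <- sl] k d.
Proof.
elim: k d => [//|k IH] d /=; rewrite sumnE !big_map.
by apply: eq_bigr => u _; rewrite IH val_subZ.
Qed.

Lemma natr_eq0 k : (k%:R == 0 :> 'Z_n) = (n %| k)%N.
Proof. by rewrite -val_eqE /= val_Zp_nat. Qed.

Lemma odd_addZ (x y : 'Z_n) : ~~ odd n -> odd (x + y : 'Z_n)%R = odd x (+) odd y.
Proof.
move=> n_even; rewrite -oddD /=; move: (x : nat) (y : nat) => {}x {}y.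
by rewrite (Zp_cast n_gt1) {2}(divn_eq (x + y) n) oddD oddM (negPf n_even) andbF.
Qed.

Lemma odd_natr k : ~~ odd n -> odd (k%:R : 'Z_n) = odd k.
Proof.
move=> n_even; rewrite val_Zp_nat // {2}(divn_eq k n) oddD oddM.
by rewrite (negPf n_even) andbF.
Qed.

Lemma odd_mulrnZ (x : 'Z_n) k : ~~ odd n -> odd (x *+ k : 'Z_n) = odd x && odd k.
Proof.
move=> n_even; elim: k => [|k IH]; first by rewrite mulr0n andbF.
by rewrite mulrS odd_addZ // IH /=; case: odd; case: odd.
Qed.

Lemma odd_oppZ (x : 'Z_n) : ~~ odd n -> odd (- x : 'Z_n) = odd x.
Proof.
move=> n_even; have := odd_addZ x (- x) n_even; rewrite subrr /=.
by case: odd; case: odd.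
Qed.

End Residues.

(** * Formal relations among the generators, and finite checks on them *)

(* (i, j, k) stands for the formal combination i a + j b + k (n/2); the       *)
(* coefficient of the involution n/2 only matters modulo 2.                   *)
Definition vec := (int * int * bool)%type.

Definition vadd (v w : vec) : vec :=
  (v.1.1 + w.1.1, v.1.2 + w.1.2, v.2 (+) w.2).
Definition vopp (v : vec) : vec := (- v.1.1, - v.1.2, v.2).
Definition vdet (v w : vec) : int := v.1.1 * w.1.2 - w.1.1 * v.1.2.

Definition gens : seq vec :=
  [:: (1, 0, false); (-1, 0, false); (0, 1, false); (0, -1, false); (0, 0, true)].

Definition signed (s : seq vec) : seq vec := s ++ map vopp s.

(* Combinations that cannot vanish because the five generators are distinct.  *)
Definition trivial_rels : seq vec :=
  [:: (2, 0, false); (0, 2, false); (1, 1, false); (1, -1, false);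
      (1, 0, true); (0, 1, true)].

(* Up to sign, the remaining nonzero sums of four generators.                 *)
Definition rels : seq vec :=
  [:: (4, 0, false); (0, 4, false); (3, 1, false); (3, -1, false);
      (1, 3, false); (1, -3, false); (2, 2, false); (2, -2, false);
      (3, 0, true); (0, 3, true); (2, 1, true); (2, -1, true);
      (1, 2, true); (1, -2, true)].

Fixpoint reach (k : nat) (v : vec) : seq vec :=
  if k is k'.+1 then flatten [seq reach k' (vadd v (vopp u)) | u <- gens]
  else [:: v].

(** These vectors cover all comparisons of two walks of length 2, or of a walk of length 3 with an
    edge. *)
Definition four_sum (v : vec) : bool :=
  [|| v == (0, 0, false), v \in signed trivial_rels | v \in signed rels].

Lemma reach3_four_sum : all (fun v => all four_sum (reach 3 v)) gens.
Proof. by vm_compute. Qed.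

Lemma reach2_four_sum :
  all (fun v => all (fun w => all four_sum (reach 2 (vadd v w))) gens) gens.
Proof. by vm_compute. Qed.

Definition zeros (r : option vec) : seq vec :=
  if r is Some v then [:: (0, 0, false); v; vopp v] else [:: (0, 0, false)].

(** The number of walks predicted when [r] is, up to sign, the only relation; [None] stands for no
    relation. *)
Definition formal_walks (r : option vec) (k : nat) (v : vec) : nat :=
  count (mem (zeros r)) (reach k v).

(** The extreme determinant 16 comes from 4a and 4b. Distinct nonopposite parallel relations, such
    as 4a and 3a + h, would force a trivial relation to vanish. *)
Lemma rels_det : all (fun v => all (fun w => (`|vdet v w| <= 16)%N &&
   ((vdet v w == 0) ==> [|| v == w, v == vopp w, vadd v w \in signed trivial_rels
     | vadd v (vopp w) \in signed trivial_rels])) (signed rels)) (signed rels).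
Proof. by vm_compute. Qed.

Definition nat_mulz (n x : nat) (i : int) : nat :=
  match i with Posz k => k * x | Negz k => k.+1 * (n - x) end.

Definition nat_ev (m a b : nat) (v : vec) : nat :=
  nat_mulz m.*2 a v.1.1 + nat_mulz m.*2 b v.1.2 + v.2 * m.

(* Two relations occur only in a few cases with m <= 6; there the number of   *)
(* walks of length 5 from 0 to d differs from that of closed walks for d <> 0.*)
Definition small_ok (m a b : nat) : bool :=
  if [&& gcdn (gcdn a b) m == 1, ~~ [&& odd a, odd b & odd m],
      ~~ (~~ odd m && ((3 * a == m) || (3 * b == m))) &
      (m, a, b) != (4, 1, 3)]%N then
    if (count (fun v => m.*2 %| nat_ev m a b v) rels <= 1)%N then true else
    let w := nat_walks m.*2 [:: a; m.*2 - a; b; m.*2 - b; m]%N 5 in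
    all (fun d => w d != w 0%N) (iota 1 (m.*2).-1)
  else true.

(** The range is 1 <= a < b < m <= 16, so m starts at 3; larger m is settled by the bound in
    [rels_det]. *)
Lemma small_okT :
  all (fun m => all (fun b => all (fun a => small_ok m a b)
    (iota 1 b.-1)) (iota 1 m.-1)) (iota 3 14).
Proof. by vm_compute. Qed.

(** A sum w + u is also u + w, so a unique decomposition forces w = u. *)
Lemma gens_double :
  all (fun v => (formal_walks None 2 (vadd v v) == 1%N) &&
    all (fun w => all (fun u => (formal_walks None 2 (vadd w u) == 1%N) ==> (w == u))
      gens) gens) (take 4 gens).
Proof. by vm_compute. Qed.

(** Formally, a nonzero sum of two generators determines the two summands up to order. *)
Lemma gens_square :
  all (fun p => all (fun q => all (fun p' => all (fun q' =>
    let v := vadd (vadd p q') (vopp (vadd q p')) in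
    four_sum v && ((v == (0, 0, false)) ==> [|| p == q, p == p' | q' == vopp p]))
    gens) gens) gens) gens.
Proof. by vm_compute. Qed.

Lemma gens_twin :
  all (fun v => all (fun w => (formal_walks (Some (2, -2, false)) 2 (vadd v w) == 4%N)
    ==> (vadd v w \in [:: (1, -1, false); (-1, 1, false)])) gens) gens.
Proof. by vm_compute. Qed.

Definition vswap (v : vec) : vec := (v.1.2, v.1.1, v.2).
Definition vflip (v : vec) : vec := (v.1.1, - v.1.2, v.2).

Definition rel_reps : seq vec :=
  [:: (4, 0, false); (3, -1, false); (2, -2, false); (3, 0, true); (2, -1, true)].

Lemma rels_reps :
  all (fun v => has (fun r => [|| v \in signed [:: r], v \in signed [:: vflip r],
    v \in signed [:: vswap r] | v \in signed [:: vswap (vflip r)]]) rel_reps)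
  (signed rels).
Proof. by vm_compute. Qed.

Lemma signed_rels_sym : all (fun v => (vswap v \in signed rels) &&
  (vflip v \in signed rels)) (signed rels).
Proof. by vm_compute. Qed.

Lemma rel_reps_sub : all (mem (signed rels)) rel_reps.
Proof. by vm_compute. Qed.

(** Cramer's rule: b is eliminated between two relations, with c and d standing for their multiples
    of h. *)
Lemma mulrz_det (R : comNzRingType) (a b c d : R) (i j i' j' : int) :
  a *~ (i * j' - i' * j) =
  (a *~ i + b *~ j + c) *~ j' - (a *~ i' + b *~ j' + d) *~ j - c *~ j' + d *~ j.
Proof.
rewrite mulrzBr !mulrzDl !mulrzA [b *~ j *~ j']mulrzAC.
move: (a *~ i *~ j') (a *~ i' *~ j) (b *~ j' *~ j) (c *~ j') (d *~ j) => x y z u v.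
by ring.
Qed.

(** * Circulant graphs of order 2m containing the involution *)

Section EvenOrder.
Variables (n m : nat).
Hypotheses (n_gt1 : (1 < n)%N) (nE : n = m.*2).

Let h : 'Z_n := m%:R.

Lemma n_even : ~~ odd n. Proof. by rewrite nE odd_double. Qed.

Lemma half_add : h + h = 0.
Proof. by apply/eqP; rewrite -natrD natr_eq0 // addnn nE. Qed.

Lemma half_opp : - h = h.
Proof. by apply/eqP; rewrite eq_sym -addr_eq0 half_add. Qed.

Lemma val_half : h = m :> nat.
Proof. by rewrite val_Zp_nat // modn_small // nE; lia. Qed.

Lemma half_neq0 : h != 0.
Proof. by rewrite -val_eqE /= val_half; lia. Qed.

Lemma double_eq0 (x : 'Z_n) : x + x = 0 -> x = 0 \/ x = h.
Proof.
rewrite -{1 2}[x]natr_Zp -natrD => /eqP; rewrite natr_eq0 // addnn [X in (X %| _)%N]nE.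
rewrite -!muln2 dvdn_pmul2r // => /dvdnP[q xE].
have := ltn_Zn n_gt1 x; rewrite [X in (_ < X)%N]nE => x_lt.
have: (q < 2)%N by nia.
case: q xE => [|[|//]] xE _; [left|right]; apply/val_inj => /=.
  by rewrite xE.
by rewrite -[RHS]/(nat_of_ord h) val_half xE mul1n.
Qed.

Lemma mulr_half_even (x : 'Z_n) : ~~ odd x -> x *+ m = 0.
Proof.
move=> x_even; rewrite -[x]natr_Zp -mulrnA; apply/eqP; 
  rewrite natr_eq0 // [X in (X %| _)%N]nE.
have /dvdnP[q ->] : (2 %| x)%N by rewrite dvdn2.
by rewrite -muln2 (mulnC m) -mulnA dvdn_mull.
Qed.

Lemma mulr_half_odd (x : 'Z_n) : odd x -> x *+ m = h.
Proof.
move=> x_odd; have : (x - 1) *+ m = 0.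
  apply: mulr_half_even; rewrite odd_addZ ?n_even // odd_oppZ ?n_even //.
  by rewrite x_odd (odd_natr n_gt1 1) ?n_even.
by rewrite mulrnBl => /subr0_eq.
Qed.

Lemma mulrb_half (c d : bool) : h *+ (c (+) d) = h *+ c + h *+ d.
Proof. by case: c; case: d; rewrite ?addr0 ?add0r //= half_add. Qed.

Section Vectors.
Variables a b : 'Z_n.

Definition ev (v : vec) : 'Z_n := a *~ v.1.1 + b *~ v.1.2 + h *+ v.2.

Lemma evD v w : ev (vadd v w) = ev v + ev w.
Proof. by rewrite /ev /= !mulrzDr mulrb_half; ring. Qed.

Lemma evN v : ev (vopp v) = - ev v.
Proof.
rewrite /ev /= !mulrNz !opprD; congr (_ + _); case: v.2 => /=.
  by rewrite mulr1n half_opp.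
by rewrite mulr0n oppr0.
Qed.

Lemma ev_gens : [seq ev v | v <- gens] = [:: a; - a; b; - b; h].
Proof.
by rewrite /ev /= !mulr0n !mulr0z !mulrNz !mulr1z ?addr0 ?add0r mulr1n.
Qed.

Lemma walks_reach k v :
  walks [:: a; - a; b; - b; h] k (ev v) = count (fun w => ev w == 0) (reach k v).
Proof.
rewrite -ev_gens; elim: k v => [|k IH] v; first by rewrite /= addn0.
rewrite -[reach k.+1 v]/(flatten [seq reach k (vadd v (vopp u)) | u <- gens]).
rewrite count_flatten -map_comp sumnE -[walks _ _ _]/(\sum_(u <- _) _)%N !big_map.
by apply: eq_bigr => u _ /=; rewrite -IH evD evN.
Qed.

End Vectors.

Variables (S : {set 'Z_n}) (phi : bool -> 'Z_n -> 'Z_n).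
Hypotheses (conn : graph_connected (cay S)) (nbip : ~ graph_bipartite (cay S)).
Hypotheses (phi_tf : twofold (cay S) phi) (phi00 : phi false 0 = 0).

(** The label of the image of the edge labelled [s] that leaves [v] in layer [i]. *)
Definition step i v s := phi (~~ i) (v + s) - phi i v.

Lemma step_in i v s : (step i v s \in S) = (s \in S).
Proof.
have [_ adj] := phi_tf; rewrite -[LHS]/(cay S _ _) adj /cay /=.
by rewrite addrC addKr.
Qed.

Lemma step_inj i v : injective (step i v).
Proof.
have [inj _] := phi_tf.
by move=> s t /addIr/inj/addrI.
Qed.

Definition spans (a b : 'Z_n) : Prop :=
  S =i [:: a; - a; b; - b; h] /\ uniq [:: a; - a; b; - b; h].

Lemma spans_swap a b : spans a b -> spans b a.
Proof.
case=> Sab uab; split=> [x|]; first by rewrite Sab !inE; do 4![case: eqP => //=].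
by rewrite (perm_uniq (permEl (perm_catCA [:: b; - b] [:: a; - a] [:: h]))).
Qed.

Lemma spans_oppl a b : spans a b -> spans (- a) b.
Proof.
case=> Sab uab; split=> [x|]; rewrite opprK.
  by rewrite Sab !inE; do 4![case: eqP => //=].
by rewrite (perm_uniq (permEl (perm_catCA [:: - a] [:: a] [:: b; - b; h]))).
Qed.

Lemma spans_oppr a b : spans a b -> spans a (- b).
Proof. by move=> /spans_swap/spans_oppl/spans_swap. Qed.

(** If a, b and m were all odd, parity would be a bipartition. *)
Lemma parity_nonbipartite a b : spans a b -> odd m -> ~~ odd a || ~~ odd b.
Proof.
case=> Sab _ m_odd; rewrite -negb_and; apply/negP => /andP[a_odd b_odd].
apply: nbip; exists (fun v : 'Z_n => odd v) => x y; rewrite /cay /= Sab => xy.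
have: odd (y - x : 'Z_n)%R.
  move: xy; rewrite !inE.
  by do 4?[case/predU1P=> [->|]] => [||||/eqP->];
    rewrite ?odd_oppZ ?n_even // val_half.
by rewrite odd_addZ ?odd_oppZ ?n_even //; case: odd; case: odd.
Qed.

Lemma connected_ind (P : 'Z_n -> Prop) :
  P 0 -> (forall x s, s \in S -> P x -> P (x + s)) -> forall x, P x.
Proof.
move=> P0 PS; apply: (connected_invariant conn _ P0) => x y xy Px.
by rewrite -(subrK x y) addrC; apply: PS.
Qed.

Lemma parity_connected a b : spans a b -> ~~ odd m -> odd a || odd b.
Proof.
case=> Sab _ m_even; apply/negPn; rewrite negb_or.
apply/negP => /andP[a_even b_even].
have := odd_natr n_gt1 1 n_even; move: (1%:R : 'Z_n) => x.
suff: ~~ odd x by move/negPf->.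
move: x; apply: connected_ind => // x s; rewrite Sab !inE => sS x_even.
rewrite odd_addZ ?n_even // (negPf x_even) /=; move: sS.
by do 4?[case/predU1P=> [->|]] => [||||/eqP->];
  rewrite ?odd_oppZ ?n_even // val_half.
Qed.

Lemma gcd_connected a b : spans a b -> gcdn (gcdn a b) m = 1%N.
Proof.
case=> Sab _; set g := gcdn _ _.
have gm : (g %| m)%N by apply: dvdn_gcdr.
have ga : (g %| a)%N by apply: dvdn_trans (dvdn_gcdl _ _) (dvdn_gcdl _ _).
have gb : (g %| b)%N by apply: dvdn_trans (dvdn_gcdl _ _) (dvdn_gcdr _ _).
have gn : (g %| n)%N by rewrite nE -muln2 dvdn_mulr.
have gD (x y : 'Z_n) : (g %| x)%N -> (g %| y)%N -> (g %| ((x + y)%R : 'Z_n))%N.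
  move=> gx gy /=; rewrite [X in (_ %% X)%N](Zp_cast n_gt1).
  by rewrite /dvdn modn_dvdm // -/(dvdn _ _) dvdn_add.
have gN (x : 'Z_n) : (g %| x)%N -> (g %| ((- x)%R : 'Z_n))%N.
  rewrite /=; move: (x : nat) => {}x gx; rewrite !(Zp_cast n_gt1).
  by rewrite /dvdn modn_dvdm // -/(dvdn _ _) dvdn_sub.
have gall : forall x : 'Z_n, (g %| x)%N.
  apply: connected_ind => [|x s]; first exact: dvdn0.
  rewrite Sab !inE => sS gx; apply: gD => //; move: sS.
  by do 4?[case/predU1P=> [->|]] => [||||/eqP->]; rewrite ?gN ?val_half.
have := gall 1%:R; rewrite val_Zp_nat // modn_small // dvdn1 => /eqP //.
Qed.

(** * Steps and walk counts under at most one relation *)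

Section Pair.
Variables a b : 'Z_n.
Hypothesis ab : spans a b.
Let sl := [:: a; - a; b; - b; h].
Let e := ev a b.

Lemma trivial_rels_neq0 v : v \in signed trivial_rels -> e v != 0.
Proof.
rewrite /signed mem_cat => v_in.
suff triv w : w \in trivial_rels -> e w != 0.
  case/orP: v_in => [/triv //|/mapP[w /triv e_w ->]].
  by rewrite /e evN oppr_eq0.
have [_ +] := ab; rewrite [uniq _]/= !inE !negb_or -!andbA.
case/and5P=> aNa ab' aNb ah /and5P[Nab NaNb Nah bNb /and3P[bh Nbh _]].
rewrite /e /ev.
do 5?[case/predU1P=> [->|]] => [|||||/eqP->];
  rewrite /= ?mulr0z ?mulr0n ?addr0 ?add0r ?mulrNz ?mulr1z ?mulr1n.
- by rewrite -[a *~ 2]/(a + a) addr_eq0.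
- by rewrite -[b *~ 2]/(b + b) addr_eq0.
- by rewrite addr_eq0.
- by rewrite subr_eq0.
- by rewrite addr_eq0 half_opp.
- by rewrite addr_eq0 half_opp.
Qed.

Definition only_rel (r : option vec) : Prop :=
  (if r is Some v then v \in signed rels /\ e v = 0 else True) /\
  forall v, v \in signed rels -> e v = 0 -> v \in zeros r.

Lemma four_sum_eq0 r v : only_rel r -> four_sum v -> (e v == 0) = (v \in zeros r).
Proof.
move=> [r0 rU] v4; apply/eqP/idP => [ev0|].
  case/or3P: v4 => [/eqP->|/trivial_rels_neq0/eqP//|v_rel].
    by case: (r) => [w|]; rewrite !inE eqxx.
  exact: rU.
have e0 : e (0, 0, false) = 0 by rewrite /e /ev /= !mulr0z mulr0n !addr0.
case: r r0 {rU} => [w [_ ew]|_]; rewrite !inE; last by move/eqP->.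
by case/or3P=> /eqP-> //; rewrite /e evN -/e ew oppr0.
Qed.

Lemma walks3_gen r v : only_rel r -> v \in gens ->
  walks sl 3 (e v) = formal_walks r 3 v.
Proof.
move=> rU v_gen; rewrite walks_reach; apply: eq_in_count => w w_in.
by apply: four_sum_eq0 => //; have /allP/(_ v v_gen)/allP/(_ w w_in) := reach3_four_sum.
Qed.

Lemma walks2_gen r v w : only_rel r -> v \in gens -> w \in gens ->
  walks sl 2 (e (vadd v w)) = formal_walks r 2 (vadd v w).
Proof.
move=> rU v_gen w_gen; rewrite walks_reach; apply: eq_in_count => u u_in.
apply: four_sum_eq0 => //.
by have /allP/(_ v v_gen)/allP/(_ w w_gen)/allP/(_ u u_in) := reach2_four_sum.
Qed.

Lemma mem_genP s : s \in S -> exists2 v, v \in gens & s = e v.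
Proof. by have [-> _] := ab; rewrite -ev_gens => /mapP. Qed.

Lemma gen_mem v : v \in gens -> e v \in S.
Proof. by have [-> _] := ab; rewrite -ev_gens => ?; apply: map_f. Qed.

(** An edge and its image have ends joined by equally many walks of length 3, since 3 is odd and the
    ends lie in opposite layers. *)
Lemma step_gen r i x v : only_rel r -> v \in gens ->
  exists2 w, w \in gens & step i x (e v) = e w /\
    formal_walks r 3 w = formal_walks r 3 v.
Proof.
move=> rU v_gen; have := gen_mem v_gen; rewrite -(step_in i x) => /mem_genP[w w_gen wE].
exists w => //; split=> //; rewrite -!walks3_gen // -wE /step.
have [Sab uab] := ab; have := walks_phi uab Sab phi_tf 3 i x (x + e v).
by rewrite addbT addrAC subrr add0r.
Qed.

End Pair.

Lemma stepK i x s : phi (~~ i) (x + s) = phi i x + step i x s.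
Proof. by rewrite [RHS]addrC subrK. Qed.

Definition fixes (s : seq 'Z_n) : Prop :=
  forall i x t, t \in s -> step i x t \in s.

(** By injectivity the image of a line cannot turn back, so its direction [d] never changes. *)
Lemma fixes_line a i x : a != - a -> fixes [:: a; - a] ->
  exists2 d, d \in [:: a; - a] &
    forall k, phi (i (+) odd k) (x + a *+ k) = phi i x + d *+ k.
Proof.
move=> aNa fix_a; have [d dE] : exists d, d = step i x a by exists (step i x a).
have d_in : d \in [:: a; - a] by rewrite dE; apply: fix_a; rewrite inE eqxx.
exists d => // k.
(* Two consecutive values of k are carried along, because the previous vertex shows which direction
   is already taken. *)
suff [] : phi (i (+) odd k) (x + a *+ k) = phi i x + d *+ k /\
  phi (i (+) odd k.+1) (x + a *+ k.+1) = phi i x + d *+ k.+1 by [].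
elim: k => [|k [IHk IHk1]].
  by rewrite !mulr0n !addr0 addbF !mulr1n addbT stepK dE.
split=> //.
set j := i (+) odd k.+1 in IHk1; set y := x + a *+ k.+1 in IHk1.
have jE : i (+) odd k.+2 = ~~ j by rewrite /j /= addbN.
have yE : x + a *+ k.+2 = y + a by rewrite /y mulrSr addrA.
have back : step j y (- a) = - d.
  have -> : step j y (- a) = phi (i (+) odd k) (x + a *+ k) - phi j y.
    rewrite /step /y mulrSr addrA addrK; congr (phi _ _ - _).
    by rewrite /j /= addbN negbK.
  by rewrite IHk IHk1 mulrSr; ring.
have fwd : step j y a != - d.
  by rewrite -back (inj_eq (@step_inj j y)).
have sE : step j y a = d.
  have : step j y a \in [:: a; - a] by apply: fix_a; rewrite inE eqxx.
  move: d_in fwd; rewrite !inE.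
  by case/orP=> /eqP-> {}fwd /orP[] /eqP sE; move: fwd; rewrite sE ?opprK ?eqxx.
by rewrite jE yE stepK IHk1 sE -addrA -mulrSr.
Qed.

(** Here m a = 0 with m odd, so m steps along a lead from 0 to 0 in the other layer, and so do their
    images. *)
Lemma fixes_odd_order a : a != - a -> fixes [:: a; - a] -> odd m -> ~~ odd a ->
  phi true 0 = 0.
Proof.
move=> aNa fix_a m_odd a_even.
have [d d_in /(_ m)] := fixes_line false 0 aNa fix_a.
rewrite m_odd phi00 mulr_half_even // addr0 add0r => ->.
by move: d_in; rewrite !inE => /orP[] /eqP->; rewrite ?mulNrn mulr_half_even ?oppr0.
Qed.

(** Here m a = h with m even, so [phi false] fixes h; a further edge h leads to 0 in the other
    layer. *)
Lemma fixes_half_line a : a != - a -> fixes [:: a; - a] ->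
  (forall i x, step i x h = h) -> ~~ odd m -> odd a -> phi true 0 = 0.
Proof.
move=> aNa fix_a fix_h m_even a_odd.
have [d d_in /(_ m)] := fixes_line false 0 aNa fix_a.
rewrite (negPf m_even) addbF phi00 mulr_half_odd // !add0r => phi_h.
have := stepK false h h; rewrite half_add fix_h phi_h => ->.
by move: d_in; rewrite !inE => /orP[] /eqP->;
  rewrite ?mulNrn mulr_half_odd // ?half_opp half_add.
Qed.

(** * The cases of no relation and of a single relation *)

Section Cases.
Variables a b : 'Z_n.
Hypothesis ab : spans a b.

Lemma spans_neq : [/\ a != - a, b != - b & forall s, s \in [:: a; - a; b; - b] -> s != h].
Proof.
have [_ +] := ab; rewrite [uniq _]/= !inE !negb_or -!andbA.
case/and5P=> aNa ab' aNb ah /and5P[Nab NaNb Nah bNb /and3P[bh Nbh _]].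
by split=> // s; rewrite !inE => /or4P[] /eqP->.
Qed.

(** The steps are injective, and the labels a, -a, b, -b are already taken. *)
Lemma fixes_half : fixes [:: a; - a] -> fixes [:: b; - b] ->
  forall i x, step i x h = h.
Proof.
have [Sab uab] := ab; have [aNa bNb neq_h] := spans_neq.
have hfix c i x : c != - c -> c \in [:: a; - a; b; - b] ->
    - c \in [:: a; - a; b; - b] -> fixes [:: c; - c] ->
    step i x h \notin [:: c; - c].
  move=> cNc c_in Nc_in fix_c; apply/negP => h_in.
  have: (size (map (step i x) [:: c; - c; h]) <= size [:: c; - c])%N.
    apply: uniq_leq_size.
      by rewrite (map_inj_uniq (@step_inj i x)) /= !inE !negb_or cNc !neq_h.
    move=> _ /mapP[t + ->]; rewrite 2![t \in _]in_cons mem_seq1 => /or3P[] /eqP-> //.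
      by apply: fix_c; rewrite inE eqxx.
    by apply: fix_c; rewrite !inE eqxx orbT.
  by [].
move=> fix_a fix_b i x.
have: step i x h \in S by rewrite step_in Sab !inE eqxx !orbT.
have := hfix b i x bNb _ _ fix_b; have := hfix a i x aNa _ _ fix_a.
rewrite Sab !inE !eqxx !orbT => /(_ isT isT) + /(_ isT isT).
by rewrite !negb_or => /andP[/negPf-> /negPf->] /andP[/negPf-> /negPf->] /eqP.
Qed.

Lemma fixes_all : fixes [:: a; - a] -> fixes [:: b; - b] -> phi true 0 = 0.
Proof.
move=> fix_a fix_b; have fix_h := fixes_half fix_a fix_b.
have [aNa bNb _] := spans_neq.
have [m_odd|m_even] := boolP (odd m).
  by case/orP: (parity_nonbipartite ab m_odd) => ?;
    [apply: (fixes_odd_order aNa)|apply: (fixes_odd_order bNb)].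
by case/orP: (parity_connected ab m_even) => ?;
  [apply: (fixes_half_line aNa)|apply: (fixes_half_line bNb)].
Qed.

Lemma fixes_gens r (G : seq vec) : only_rel a b r ->
  {subset G <= gens} ->
  all (fun v => all (fun w => (formal_walks r 3 w == formal_walks r 3 v) ==> (w \in G))
    gens) G ->
  fixes [seq ev a b v | v <- G].
Proof.
move=> rU G_gens G_closed i x _ /mapP[v vG ->].
have [w w_gen [-> fw]] := step_gen ab i x rU (G_gens _ vG).
apply: map_f; have /allP/(_ v vG)/allP/(_ w w_gen) := G_closed.
by rewrite fw eqxx.
Qed.

Let ev_a : [seq ev a b v | v <- take 2 gens] = [:: a; - a].
Proof. by rewrite map_take ev_gens. Qed.
Let ev_b : [seq ev a b v | v <- take 2 (drop 2 gens)] = [:: b; - b].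
Proof. by rewrite map_take map_drop ev_gens. Qed.
Let ev_h : [seq ev a b v | v <- drop 4 gens] = [:: h].
Proof. by rewrite map_drop ev_gens. Qed.

Let gens_a : {subset take 2 gens <= gens}. Proof. exact: mem_take. Qed.
Let gens_b : {subset take 2 (drop 2 gens) <= gens}.
Proof. by move=> v /mem_take/mem_drop. Qed.
Let gens_h : {subset drop 4 gens <= gens}. Proof. exact: mem_drop. Qed.

Lemma case_2a_b_h : only_rel a b (Some (2, -1, true)) -> phi true 0 = 0.
Proof.
move=> rU; apply: fixes_all.
  by rewrite -ev_a; apply: (fixes_gens rU gens_a); vm_compute.
by rewrite -ev_b; apply: (fixes_gens rU gens_b); vm_compute.
Qed.

(** Walk counts isolate {a, -a}; an edge b = 3a spans three steps of a line, whose image is again a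
    line. *)
Lemma case_3a_b : only_rel a b (Some (3, -1, false)) -> phi true 0 = 0.
Proof.
move=> rU; have bE : b = a *+ 3.
  have [[_ /eqP +] _] := rU; rewrite /ev /= mulr0n addr0 mulrNz mulr1z subr_eq0.
  by rewrite eq_sym => /eqP.
have fix_a : fixes [:: a; - a].
  by rewrite -ev_a; apply: (fixes_gens rU gens_a); vm_compute.
have [aNa _ _] := spans_neq.
apply: fixes_all => // i x t.
have step3 c : c != - c -> fixes [:: c; - c] ->
    step i x (c *+ 3) \in [:: c *+ 3; - (c *+ 3)].
  move=> cNc fix_c; have [d d_in /(_ 3)] := fixes_line i x cNc fix_c.
  rewrite addbT /step => ->; rewrite addrC addKr.
  by move: d_in; rewrite !inE => /orP[] /eqP->; rewrite ?mulNrn eqxx ?orbT.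
rewrite bE !inE => /orP[] /eqP->; first by have := step3 _ aNa fix_a; rewrite !inE.
have mem_swap u : (u \in [:: - a; - - a]) = (u \in [:: a; - a]).
  by rewrite opprK !inE orbC.
have fix_Na : fixes [:: - a; - - a] by move=> j y u; rewrite !mem_swap; apply: fix_a.
have := step3 (- a) _ fix_Na; rewrite opprK eq_sym mulNrn opprK !inE orbC; exact.
Qed.

(* {0, a, -a, h} induces a K4, whose double cover is a cube in which the      *)
(* vertex opposite to (0, 0) is (0, 1).                                       *)
Lemma case_4a : only_rel a b (Some (4, 0, false)) -> phi true 0 = 0.
Proof.
move=> rU; have a4 : a *+ 4 = 0.
  by have [[_ +] _] := rU; rewrite /ev /= mulr0n mulr0z !addr0.
have [Sab uab] := ab; have [aNa _ neq_h] := spans_neq.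
have a2 : a *+ 2 = h.
  have [|//|//] := @double_eq0 (a *+ 2); first by rewrite -mulrnDr.
  by move/eqP; rewrite mulr2n addr_eq0 (negPf aNa).
have fix_K : fixes ([:: a; - a] ++ [:: h]).
  rewrite -ev_a -ev_h -map_cat; apply: (fixes_gens rU); last by vm_compute.
  by move=> v; rewrite mem_cat => /orP[/gens_a|/gens_h].
have KE t : t \in [:: a; - a; h] -> exists k, t = a *+ k.
  rewrite !inE => /or3P[] /eqP->; first by exists 1%N.
    by exists 3; apply/eqP; rewrite eq_sym -addr_eq0 -mulrSr a4.
  by exists 2.
have K_H i x t : t \in [:: a; - a; h] -> exists k, phi (~~ i) (x + t) = phi i x + a *+ k.
  by move=> tK; have [k tE] := KE _ (fix_K i x t tK); exists k; rewrite stepK tE.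
have aK : a \in [:: a; - a; h] by rewrite inE eqxx.
have NaK : - a \in [:: a; - a; h] by rewrite !inE eqxx orbT.
have hK : h \in [:: a; - a; h] by rewrite !inE eqxx !orbT.
(* The closed walk 0, h, a, 0 has odd length, so it ends at 0 in the other layer. *)
have [k phi0] : exists k, phi true 0 = a *+ k.
  have [k1 E1] := K_H false 0 h hK.
  have [k2 E2] := K_H true h _ NaK.
  have [k3 E3] := K_H false a _ NaK.
  exists (k1 + k2 + k3)%N; rewrite /= addrN in E3; rewrite E3.
  rewrite /= -a2 mulr2n addrK in E2; rewrite E2.
  by rewrite -mulr2n a2 -[h]add0r E1 phi00 add0r !mulrnDr.
(* [phi true] already sends a, -a and h into this three-element set, which leaves no room for the
   image of 0. *)
have [phiK|] := boolP (phi true 0 \in [:: a; - a; h]).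
  have: (size (map (phi true) [:: 0%R; a; - a; h]) <= size [:: a; - a; h])%N.
    apply: uniq_leq_size.
      have a0 : a != 0 by apply: contraNneq aNa => ->; rewrite oppr0.
      have [inj _] := phi_tf; rewrite (map_inj_uniq (inj true)) /= !inE !negb_or.
      rewrite !(eq_sym 0) oppr_eq0 a0 half_neq0 aNa.
      by rewrite !neq_h // !inE eqxx ?orbT.
    move=> _ /mapP[t t_in ->]; move: t_in; rewrite in_cons => /predU1P[-> //|tK].
    by have := fix_K false 0 t tK; rewrite /step phi00 add0r subr0.
  by [].
have : phi true 0 = a *+ (k %% 4).
  by rewrite phi0 {1}(divn_eq k 4) mulrnDr mulnC mulrnA a4 mul0rn add0r.
have: (k %% 4 < 4)%N by rewrite ltn_mod.
case: (k %% 4)%N => [|[|[|[|//]]]] _ -> //; rewrite ?inE ?eqxx //.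
  by rewrite a2 eqxx !orbT.
by rewrite -addr_eq0 -mulrSr a4 eqxx orbT.
Qed.

Lemma walks2_gt0 d : (0 < walks [:: a; - a; b; - b; h] 2 d)%N ->
  exists v w, [/\ v \in gens, w \in gens & d = ev a b (vadd v w)].
Proof.
rewrite -ev_gens; set sl := map _ _.
have [/hasP[u /mapP[v v_gen ->] /hasP[t /mapP[w w_gen ->] /eqP dE]] _|none] :=
    boolP (has (fun u => has (fun t => d - u - t == 0) sl) sl).
  exists v, w; split=> //; rewrite evD; apply/eqP.
  by rewrite -subr_eq0 opprD addrA dE.
rewrite /= big1_seq // => u /andP[_ u_in]; rewrite big1_seq // => t /andP[_ t_in].
by have /hasPn/(_ u u_in)/hasPn/(_ t t_in)/negPf-> := none.
Qed.

(* h is the only vertex joined to 0 by exactly four walks of length 2.        *)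
Lemma case_2a_2b : only_rel a b (Some (2, -2, false)) -> phi true 0 = 0.
Proof.
move=> rU; have fix_h i x : step i x h = h.
  have: fixes [:: h] by rewrite -ev_h; apply: (fixes_gens rU gens_h); vm_compute.
  by move/(_ i x h); rewrite !inE eqxx => /(_ isT)/eqP.
have [Sab uab] := ab.
have ev1 : ev a b (1, -1, false) = a - b.
  by rewrite /ev /= mulr0n addr0 mulrNz !mulr1z.
have evN1 : ev a b (-1, 1, false) = b - a.
  by rewrite /ev /= mulr0n addr0 mulrNz !mulr1z addrC.
have aBb : a - b = h.
  have [||//] := @double_eq0 (a - b).
    have [[_ +] _] := rU; rewrite /ev /= mulr0n addr0 mulrNz.
    by rewrite -[a *~ 2]/(a + a) -[b *~ 2]/(b + b) => <-; ring.
  move/subr0_eq => abE; move: uab; rewrite /= abE !inE eqxx.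
  by rewrite !orbT.
have walks_h : walks [:: a; - a; b; - b; h] 2 h = 4%N.
  have hE : h = ev a b (vadd (1, 0, false) (0, -1, false)) by rewrite -aBb -ev1.
  by rewrite [X in walks _ _ X]hE (walks2_gen ab rU).
have := walks_phi uab Sab phi_tf 2 false 0 h.
rewrite phi00 !subr0 walks_h [odd 2]/= => walks_ph.
have [|v [w [v_gen w_gen phE]]] := @walks2_gt0 (phi false h).
  by rewrite walks_ph.
move: walks_ph; rewrite phE (walks2_gen ab rU) // => fw.
have phi_h : phi false h = h.
  have /allP/(_ v v_gen)/allP/(_ w w_gen) := gens_twin; rewrite fw phE.
  move=> /=; rewrite !inE => /orP[] /eqP->; rewrite ?ev1 ?evN1 //.
  by rewrite -opprB aBb half_opp.
by have := stepK false h h; rewrite half_add fix_h phi_h half_add.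
Qed.

(** As m is odd, 3a = h makes a odd, hence b is even; walk counts isolate {b, -b}. *)
Lemma case_3a_h : only_rel a b (Some (3, 0, true)) -> odd m -> phi true 0 = 0.
Proof.
move=> rU m_odd; have a3 : a *+ 3 = h.
  have [[_ /eqP +] _] := rU; rewrite /ev /= mulr0z addr0 mulr1n addr_eq0 half_opp.
  by move/eqP.
have [_ bNb _] := spans_neq.
have fix_b : fixes [:: b; - b].
  by rewrite -ev_b; apply: (fixes_gens rU gens_b); vm_compute.
apply: (fixes_odd_order bNb fix_b m_odd).
have := parity_nonbipartite ab m_odd.
by have := odd_mulrnZ n_gt1 a 3 n_even; rewrite a3 val_half m_odd andbT => <-.
Qed.

(* The pair acts affinely: the step along s does not depend on the base       *)
(* point, because the sum of two generators determines them.                  *)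
Lemma case_generic : only_rel a b None -> phi true 0 = 0.
Proof.
move=> rU; have fix_h i x : step i x h = h.
  have: fixes [:: h] by rewrite -ev_h; apply: (fixes_gens rU gens_h); vm_compute.
  by move/(_ i x h); rewrite !inE eqxx => /(_ isT)/eqP.
have [Sab uab] := ab; have [inj _] := phi_tf.
have straight i x v : v \in take 4 gens ->
    step (~~ i) (x + ev a b v) (ev a b v) = step i x (ev a b v).
  move=> v4; have v_gen : v \in gens by apply: mem_take v4.
  have [w w_gen [wE _]] := step_gen ab i x rU v_gen.
  have [u u_gen [uE _]] := step_gen ab (~~ i) (x + ev a b v) rU v_gen.
  have := walks_phi uab Sab phi_tf 2 i x (x + ev a b v + ev a b v).
  have -> : phi (i (+) odd 2) (x + ev a b v + ev a b v) - phi i x =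
      ev a b (vadd w u).
    by rewrite evD addbF -{1}[i]negbK stepK uE stepK wE; ring.
  have -> : x + ev a b v + ev a b v - x = ev a b (vadd v v) by rewrite evD; ring.
  rewrite !(walks2_gen ab rU) // uE wE => fw.
  have /allP/(_ v v4)/andP[/eqP v1 /allP/(_ w w_gen)/allP/(_ u u_gen)] := gens_double.
  by rewrite fw v1 => /eqP->.
(* Follow the two ways around the parallelogram x, x + v, x + v + w, x + w and compare the
   images. *)
have parallel i x v w : v \in gens -> w \in gens ->
    step (~~ i) (x + ev a b w) (ev a b v) = step i x (ev a b v).
  move=> v_gen w_gen.
  have [v4|v_h] : v \in take 4 gens \/ ev a b v = h.
    move: (v_gen); rewrite -[gens](cat_take_drop 4) mem_cat => /orP[]; first by left.
    by move/(map_f (ev a b)); rewrite ev_h inE => /eqP; right.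
  2: by rewrite v_h !fix_h.
  have [<-|vw] := eqVneq (ev a b v) (ev a b w); first exact: straight.
  have [wN|wN] := eqVneq (ev a b w) (- ev a b v).
    have := straight (~~ i) (x + ev a b w) v v4.
    by rewrite wN subrK negbK.
  have [p p_gen [pE _]] := step_gen ab i x rU v_gen.
  have [q q_gen [qE _]] := step_gen ab i x rU w_gen.
  have [p' p'_gen [p'E _]] := step_gen ab (~~ i) (x + ev a b w) rU v_gen.
  have [q' q'_gen [q'E _]] := step_gen ab (~~ i) (x + ev a b v) rU w_gen.
  have E1 : phi i (x + ev a b v + ev a b w) = phi i x + ev a b p + ev a b q'.
    by rewrite -{1}[i]negbK stepK q'E stepK pE.
  have E2 : phi i (x + ev a b v + ev a b w) = phi i x + ev a b q + ev a b p'.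
    by rewrite addrAC -{1}[i]negbK stepK p'E stepK qE.
  have /allP/(_ p p_gen)/allP/(_ q q_gen)/allP/(_ p' p'_gen)/allP/(_ q' q'_gen)/=
    /andP[v4s] := gens_square.
  have /eqP : ev a b (vadd (vadd p q') (vopp (vadd q p'))) = 0.
    rewrite evD evN !evD.
    have -> : ev a b p + ev a b q' - (ev a b q + ev a b p') =
      phi i x + ev a b p + ev a b q' - (phi i x + ev a b q + ev a b p') by ring.
    by rewrite -E1 -E2 subrr.
  rewrite (four_sum_eq0 ab rU v4s) inE => -> /or3P[] /eqP pq.
  - case/negP: vw; apply/eqP; apply: (@step_inj i x); by rewrite pE qE pq.
  - by rewrite p'E pE pq.
  - have : phi i (x + ev a b v + ev a b w) = phi i x.
      by rewrite E1 pq evN addrK.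
    move/inj; rewrite -addrA -[RHS]addr0 => /addrI/eqP.
    by rewrite addrC addr_eq0 (negPf wN).
have sum_step s : s \in S -> step false ^~ s =1 step true ^~ s.
  move=> /(mem_genP ab)[v v_gen ->].
  apply: (alternating_const conn nbip) => x y; rewrite /cay /=.
  move=> /(mem_genP ab)[w w_gen yx].
  have -> : y = x + ev a b w by rewrite -yx addrC subrK.
  by rewrite (parallel true) // (parallel false).
(* The difference of the two permutations changes sign along each edge, so it equals its own
   negative and can only be 0 or h at 0. *)
have delta : (fun x => phi true x - phi false x) =1 (fun x => phi false x - phi true x).
  apply: (alternating_const conn nbip) => x y; rewrite /cay /= => yxS.
  have -> : y = x + (y - x) by rewrite addrC subrK.
  have Et := stepK false x (y - x); have Ef := stepK true x (y - x).
  rewrite /= in Et Ef; rewrite Et Ef -(sum_step _ yxS).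
  by split; ring.
have := delta 0; rewrite phi00 subr0 sub0r => d0.
have [||ph] := @double_eq0 (phi true 0) => //.
  by rewrite {1}d0 addNr.
(* The value h would give [phi false h = h + h = 0 = phi false 0]. *)
have := stepK true 0 h; rewrite add0r fix_h ph half_add /= -phi00 => /inj h0.
by have := half_neq0; rewrite h0 eqxx.
Qed.

End Cases.

(** * Reduction to one relation, up to symmetry *)

Definition unique_rel (a b : 'Z_n) : Prop :=
  forall v w, v \in signed rels -> w \in signed rels ->
    ev a b v = 0 -> ev a b w = 0 -> v \in [:: w; vopp w].

Lemma ev_swap a b v : ev b a v = ev a b (vswap v).
Proof. by rewrite /ev /= [X in X + _]addrC. Qed.

Lemma ev_flip a b v : ev a (- b) v = ev a b (vflip v).
Proof. by rewrite /ev /= mulNrz mulrNz. Qed.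

Lemma unique_rel_swap a b : unique_rel a b -> unique_rel b a.
Proof.
move=> uab v w v_rel w_rel; rewrite !(ev_swap a b) => v0 w0.
have /allP sym := signed_rels_sym.
have /andP[v'_rel _] := sym v v_rel; have /andP[w'_rel _] := sym w w_rel.
have := uab _ _ v'_rel w'_rel v0 w0.
by case: v w {v_rel w_rel v0 w0 v'_rel w'_rel} => [[vi vj] vk] [[wi wj] wk];
  rewrite !inE => /orP[] /eqP[-> -> ->]; rewrite eqxx ?orbT.
Qed.

Lemma unique_rel_flip a b : unique_rel a b -> unique_rel a (- b).
Proof.
move=> uab v w v_rel w_rel; rewrite !ev_flip => v0 w0.
have /allP sym := signed_rels_sym.
have /andP[_ v'_rel] := sym v v_rel; have /andP[_ w'_rel] := sym w w_rel.
have := uab _ _ v'_rel w'_rel v0 w0.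
by case: v w {v_rel w_rel v0 w0 v'_rel w'_rel} => [[vi vj] vk] [[wi wj] wk];
  rewrite !inE => /orP[] /eqP[-> /oppr_inj-> ->]; rewrite eqxx ?orbT.
Qed.

Lemma unique_only_rel a b v : unique_rel a b -> v \in signed rels ->
  ev a b v = 0 -> only_rel a b (Some v).
Proof.
move=> uab v_rel v0; split=> // w w_rel w0.
by rewrite inE uab ?orbT.
Qed.

(** The last clause keeps the family of order 12k away; all clauses survive exchanging a and b or
    negating b, which reduces a relation to [rel_reps]. *)
Definition admissible (a b : 'Z_n) : Prop :=
  [/\ spans a b, unique_rel a b & odd m || (a *+ 3 != h) && (b *+ 3 != h)].

Lemma admissible_swap a b : admissible a b -> admissible b a.
Proof.
by case=> /spans_swap ? /unique_rel_swap ? ?; split=> //; rewrite [X in _ || X]andbC.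
Qed.

Lemma admissible_flip a b : admissible a b -> admissible a (- b).
Proof.
case=> /spans_oppr ? /unique_rel_flip ?; split=> //.
by rewrite mulNrn eqr_oppLR half_opp.
Qed.

Lemma admissible_rep a b r : admissible a b -> r \in rel_reps -> ev a b r = 0 ->
  phi true 0 = 0.
Proof.
move=> [ab uab nfam] r_rep r0.
have /allP/(_ r r_rep) r_rel := rel_reps_sub.
have := unique_only_rel uab r_rel r0; move: r_rep.
rewrite !inE => /or4P[/eqP->|/eqP->|/eqP->|/orP[] /eqP rE].
- exact: (case_4a ab).
- exact: (case_3a_b ab).
- exact: (case_2a_2b ab).
- move: r0; rewrite rE => r0 rU; apply: (case_3a_h ab rU).
  case/orP: nfam => // /andP[/eqP[]].
  move: r0; rewrite /ev /= mulr0z addr0 mulr1n => /eqP.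
  by rewrite addr_eq0 half_opp => /eqP.
- by rewrite rE; exact: (case_2a_b_h ab).
Qed.

Lemma admissible_stable a b : admissible a b -> phi true 0 = 0.
Proof.
move=> adm; have [ab uab _] := adm.
have [/hasP[v v_rel /eqP v0]|/hasPn none] :=
    boolP (has (fun v => ev a b v == 0) (signed rels)); last first.
  by apply: (case_generic ab); split=> // v /none/eqP.
have pm u : v \in signed [:: u] -> ev a b u = 0.
  rewrite !inE => /orP[] /eqP vE; move: v0; rewrite vE ?evN // => /eqP.
  by rewrite oppr_eq0 => /eqP.
have /allP/(_ v v_rel)/hasP[r r_rep] := rels_reps.
case/or4P=> /pm r0.
- exact: admissible_rep adm r_rep r0.
- by apply: (admissible_rep (admissible_flip adm) r_rep); rewrite ev_flip.
- by apply: (admissible_rep (admissible_swap adm) r_rep); rewrite (ev_swap a b).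
- apply: (admissible_rep (admissible_flip (admissible_swap adm)) r_rep).
  by rewrite ev_flip (ev_swap a b).
Qed.

(* Eliminating b (resp. a) from two relations shows that a (resp. b), hence   *)
(* every vertex, is killed by twice their determinant.                        *)
Lemma rel_det_dvd a b v w : spans a b -> ev a b v = 0 -> ev a b w = 0 ->
  (m %| `|vdet v w|)%N.
Proof.
move=> [Sab _] v0 w0; set D := vdet v w.
have hz (c : bool) (z : int) : (h *+ c *~ z) *~ 2 = 0.
  have -> (x : 'Z_n) : x *~ 2 = x + x by [].
  by rewrite -mulrzDl; case: c; rewrite ?mulr1n ?half_add ?mulr0n ?addr0 mul0rz.
have kill_a : (a *~ D) *~ 2 = 0.
  have -> : a *~ D = ev a b v *~ w.1.2 - ev a b w *~ v.1.2
      - (h *+ v.2) *~ w.1.2 + (h *+ w.2) *~ v.1.2.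
    exact: mulrz_det.
  by rewrite v0 w0 !mul0rz subrr sub0r mulrzDl mulNrz !hz oppr0 addr0.
have kill_b : (b *~ D) *~ 2 = 0.
  have -> : b *~ D = - (ev a b v *~ w.1.1 - ev a b w *~ v.1.1
      - (h *+ v.2) *~ w.1.1 + (h *+ w.2) *~ v.1.1).
    rewrite !(ev_swap b a) -mulrz_det -mulrNz /= opprB /D /vdet.
    by rewrite [w.1.1 * _]mulrC [v.1.1 * _]mulrC.
  by rewrite v0 w0 !mul0rz subrr sub0r mulNrz mulrzDl mulNrz !hz oppr0 addr0 oppr0.
have kill : forall x : 'Z_n, (x *~ D) *~ 2 = 0.
  apply: connected_ind => [|x s]; first by rewrite !mul0rz.
  rewrite Sab !inE => sS xD; rewrite !mulrzDl xD add0r; move: sS.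
  do 4?[case/predU1P=> [->|]] => [||||/eqP->]; rewrite ?mulNrz ?kill_a ?kill_b ?oppr0 //.
  exact: (hz true D).
move: (kill 1) => {kill kill_a kill_b}; move: D => D /eqP.
have dvd2 k : (1%:R *+ k *+ 2 == 0 :> 'Z_n) = (m %| k)%N.
  by rewrite -mulrnA natr_eq0 // muln2 [X in (X %| _)%N]nE -!muln2 dvdn_pmul2r.
case: D => k /=; first by rewrite dvd2.
by rewrite NegzE mulrNz mulNrz oppr_eq0 dvd2.
Qed.

(** The determinant is a multiple of m of size at most 16, hence zero, and the relations are
    parallel. *)
Lemma large_unique_rel a b : spans a b -> (16 < m)%N -> unique_rel a b.
Proof.
move=> ab m_gt v w v_rel w_rel v0 w0.
have /allP/(_ v v_rel)/allP/(_ w w_rel)/andP[det_le] := rels_det.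
have : vdet v w == 0.
  rewrite -absz_eq0 -leqn0 leqNgt; apply/negP => det_gt0.
  have := dvdn_leq det_gt0 (rel_det_dvd ab v0 w0); lia.
move=> -> /or4P[/eqP->|/eqP->|triv|triv]; rewrite ?inE ?eqxx ?orbT //.
  by have := trivial_rels_neq0 ab triv; rewrite evD v0 w0 addr0 eqxx.
by have := trivial_rels_neq0 ab triv; rewrite evD evN v0 w0 subrr eqxx.
Qed.

Lemma nat_evE (a b : 'Z_n) v : (nat_ev m a b v)%:R = ev a b v.
Proof.
have mulzE (x : 'Z_n) i : (nat_mulz m.*2 x i)%:R = x *~ i.
  case: i => k /=; first by rewrite mulnC mulrnA natr_Zp.
  rewrite mulnC mulrnA natrB -?nE ?(ltnW (ltn_Zn n_gt1 x)) // natr_Zp NegzE mulrNz.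
  suff -> : n%:R = 0 :> 'Z_n by rewrite sub0r mulNrn.
  by apply/eqP; rewrite natr_eq0.
by rewrite /nat_ev !natrD !mulzE mulnC mulrnA.
Qed.

Lemma small_stable (a b : 'Z_n) : spans a b -> (0 < a)%N -> (a < b)%N -> (b < m)%N ->
  (m <= 16)%N -> ~~ (~~ odd m && ((3 * a == m) || (3 * b == m))%N) ->
  (m, a : nat, b : nat) != (4, 1, 3)%N -> unique_rel a b \/ phi true 0 = 0.
Proof.
move=> ab a_gt0 ltab ltbm m_le nfam nexc.
have : small_ok m a b.
  have /allP/(_ m) := small_okT; rewrite mem_iota => /(_ ltac:(lia)).
  move=> /allP/(_ (b : nat)); rewrite mem_iota => /(_ ltac:(lia)).
  by move=> /allP/(_ (a : nat)); rewrite mem_iota; apply; lia.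
have npar : ~~ [&& odd a, odd b & odd m].
  apply/negP => /and3P[a_odd b_odd m_odd].
  by have := parity_nonbipartite ab m_odd; rewrite a_odd b_odd.
rewrite /small_ok ifT; last by rewrite (gcd_connected ab) npar nfam nexc.
case: ifP => [cnt _|_ /allP sep]; [left|right].
  move=> v w v_rel w_rel v0 w0.
  have norm u : u \in signed rels -> ev a b u = 0 ->
      exists2 u', u' \in [seq v <- rels | (m.*2 %| nat_ev m a b v)%N] &
        u \in [:: u'; vopp u'].
    rewrite mem_cat => /orP[u_in u0|/mapP[u' u_in ->] u0].
      exists u; last by rewrite inE eqxx.
      by rewrite mem_filter u_in -nE -(natr_eq0 n_gt1) nat_evE u0 eqxx.
    exists u'; last by rewrite !inE eqxx orbT.
    rewrite mem_filter u_in -nE -(natr_eq0 n_gt1) nat_evE andbT.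
    by rewrite -oppr_eq0 -evN u0.
  have [v' v'_in vE] := norm v v_rel v0; have [w' w'_in wE] := norm w w_rel w0.
  have vw : v' = w'.
    move: cnt v'_in w'_in; rewrite -size_filter.
    by case: filter => [|z [|]] //= _; rewrite !inE => /eqP-> /eqP->.
  have vopK z : vopp (vopp z) = z by case: z => -[z1 z2] z3; rewrite /vopp /= !opprK.
  move: vE wE; rewrite vw !inE => /orP[] /eqP-> /orP[] /eqP->;
    by rewrite ?vopK eqxx ?orbT.
have valN (x : 'Z_n) : (0 < x)%N -> nat_of_ord (- x) = (m.*2 - x)%N.
  move=> x_gt0; rewrite /=; have := ltn_Zn n_gt1 x.
  move: (x : nat) x_gt0 => {}x x_gt0; rewrite (Zp_cast n_gt1) nE => x_lt.
  by rewrite modn_small //; lia.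
have slE : [seq nat_of_ord u | u <- [:: a; - a; b; - b; h]] =
    [:: a : nat; m.*2 - a; b : nat; m.*2 - b; m]%N.
  by rewrite [LHS]/= -!valN ?val_half //; apply: leq_ltn_trans ltab.
(* Length 5 is odd, so the count from [phi false 0 = 0] to [phi true 0] equals that of closed
   walks. *)
have [Sab uab] := ab; have := walks_phi uab Sab phi_tf 5 false 0 0.
rewrite phi00 subrr subr0 !(nat_walksE n_gt1) slE [X in nat_walks X]nE => wE.
apply/eqP/negPn/negP => phi_neq0; have := sep (phi true 0).
rewrite wE eqxx mem_iota => abs.
suff /abs : (0 < phi true 0%R < 1 + (m.*2).-1)%N by [].
have := ltn_Zn n_gt1 (phi true 0).
have : (0 < phi true 0%R)%N by rewrite lt0n.
lia.
Qed.

(** Since 3x < 3m, the only natural number congruent to m modulo 2m that 3x can be is m. *)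
Lemma triple_half (x : 'Z_n) : (x < m)%N -> (x *+ 3 == h) = (3 * x == m)%N.
Proof.
move=> x_lt.
have -> : (x *+ 3 == h) = (nat_of_ord (x *+ 3) == nat_of_ord h)%N by [].
rewrite val_half -[x in LHS]natr_Zp -mulrnA val_Zp_nat // (mulnC 3).
move: (x : nat) x_lt => {}x x_lt; rewrite nE -addnn.
have [lt|le] := ltnP (x * 3) (m + m); first by rewrite modn_small.
rewrite -(subnK le) modnDr modn_small; lia.
Qed.

Lemma stable_or_exceptional (a b : 'Z_n) :
  spans a b -> (0 < a)%N -> (a < b)%N -> (b < m)%N ->
  [\/ phi true 0 = 0, ~~ odd m /\ (a *+ 3 = h \/ b *+ 3 = h) |
      (m, a : nat, b : nat) = (4, 1, 3)%N].
Proof.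
move=> ab a_gt0 ltab ltbm.
have [nfam|] := boolP (odd m || (a *+ 3 != h) && (b *+ 3 != h)); last first.
  rewrite negb_or negb_and !negbK => /andP[m_even ab3].
  by constructor 2; split=> //; case/orP: ab3 => /eqP; [left|right].
have [exc|nexc] := eqVneq (m, a : nat, b : nat) (4, 1, 3)%N; first by constructor 3.
constructor 1.
have [m_le|m_gt] := leqP m 16; last first.
  by apply: (@admissible_stable a b); split=> //; apply: large_unique_rel.
have [|uab|//] := small_stable ab a_gt0 ltab ltbm m_le _ nexc.
  rewrite negb_and negbK negb_or -!triple_half //; exact: ltn_trans ltbm.
exact: (@admissible_stable a b).
Qed.

End EvenOrder.

(** * Instability and Wilson types of the listed graphs *)

Section Wilson.
Variables (n : nat) (S : {set 'Z_n}).
Hypothesis n_gt1 : (1 < n)%N.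

Lemma mem_multiples2 (x : 'Z_n) : ~~ odd n -> (x \in multiples n 2) = ~~ odd x.
Proof.
move=> n_even; apply/imsetP/idP => [[y _ ->]|x_even].
  by rewrite odd_mulrnZ // andbF.
exists (x./2)%:R => //; rewrite -mulrnA muln2 halfK (negPf x_even) subn0.
by rewrite natr_Zp.
Qed.

(** Translate by h the even vertices of one layer and the odd ones of the other. Across an edge of
    odd label both ends move or neither does; across one of even label exactly one moves, and the
    label stays in S. *)
Lemma wilson_C1_unstable : wilson_C1 S -> unstable (cay S).
Proof.
move=> [n_even [h [h_neq0]]]; rewrite mem_multiples2 // => h_even trE.
have mem_shift (d : 'Z_n) : ~~ odd d -> (h + d \in S) = (d \in S).
  move=> d_even.
  have SeE (x : 'Z_n) : ~~ odd x -> (x \in S :&: multiples n 2) = (x \in S).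
    by move=> x_even; rewrite inE mem_multiples2 // x_even andbT.
  have hd_even : ~~ odd (h + d : 'Z_n)%R.
    by rewrite odd_addZ // (negPf h_even) (negPf d_even).
  rewrite -(SeE (h + d)) // -(SeE d) // -{1}trE.
  by rewrite /translate (mem_imset _ _ (addrI h)).
pose phi i (x : 'Z_n) := if odd x == i then h + x else x.
have phi_odd i x : odd (phi i x) = odd x.
  by rewrite /phi; case: eqP => // _; rewrite odd_addZ // (negPf h_even).
apply: (@twofold_unstable _ _ phi 0); last first.
  by rewrite /phi /= addr0 => /eqP; rewrite (negPf h_neq0).
split=> [i x y eqxy|i x y].
  have := congr1 (fun z : 'Z_n => odd z) eqxy; rewrite !phi_odd => odd_xy.
  by move: eqxy; rewrite /phi odd_xy; case: eqP => // _ /addrI.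
rewrite /cay /=.
have [odd_xy|odd_xy] := eqVneq (odd x) (odd y); last first.
  have -> : phi (~~ i) y - phi i x = y - x; last by [].
  rewrite /phi; have -> : (odd y == ~~ i) = (odd x == i).
    by case: odd odd_xy; case: odd => //; case: i.
  by case: eqP => // _; ring.
have d_even : ~~ odd (y - x : 'Z_n)%R.
  by rewrite odd_addZ // odd_oppZ // odd_xy addbb.
rewrite /phi odd_xy; have [yi|yi] := eqVneq (odd y) i.
  have -> : (odd y == ~~ i) = false by rewrite yi; case: (i).
  rewrite -(mem_shift (y - (h + x))).
    by congr (_ \in S); ring.
  have -> : y - (h + x) = y - x - h by ring.
  by rewrite odd_addZ // odd_oppZ // (negPf h_even) addbF.
have -> : (odd y == ~~ i) by case: odd yi; case: (i).
by rewrite -addrA mem_shift.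
Qed.

Lemma odd_intr (s : int) : ~~ odd n -> odd (s%:~R : 'Z_n) = ~~ (2 %| s)%Z.
Proof.
move=> n_even; rewrite dvdzE dvdn2 negbK; case: s => k; first by rewrite -pmulrn odd_natr.
by rewrite NegzE mulrNz odd_oppZ // -pmulrn odd_natr // abszN.
Qed.

(** The witness 4k permutes the even labels 2k, 6k, -2k cyclically. *)
Lemma family_12k_C1 : family_12k S -> wilson_C1 S.
Proof.
move=> [k [s [k_gt0 s_odd nE SE]]].
have n_even : ~~ odd n by rewrite nE oddM.
have nk : (12 * k)%:R = 0 :> 'Z_n by apply/eqP; rewrite natr_eq0 // nE.
split=> //; exists (4 * k)%:R; split.
- by rewrite natr_eq0 // nE gtnNdvd; lia.
- by rewrite mem_multiples2 // odd_natr // oddM.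
apply/eqP; rewrite eqEcard card_imset ?leqnn ?andbT; last exact: addrI.
apply/subsetP => _ /imsetP[x + ->]; rewrite !inE !mem_multiples2 // => /andP[xS x_even].
rewrite odd_addZ // odd_natr // oddM /= x_even andbT; move: xS x_even.
have r6 : (4 * k)%:R + (2 * k)%:R = (6 * k)%:R :> 'Z_n.
  by rewrite -natrD; congr (_%:R); lia.
have r2 : (4 * k)%:R - (2 * k)%:R = (2 * k)%:R :> 'Z_n.
  by apply/eqP; rewrite subr_eq -natrD; apply/eqP; congr (_%:R); lia.
have rN2 : (4 * k)%:R + (6 * k)%:R = - (2 * k)%:R :> 'Z_n.
  by apply/eqP; rewrite -addr_eq0 -!natrD -nk; apply/eqP; congr (_%:R); lia.
rewrite SE !inE -!orbA => /or4P[/eqP->|/eqP->|/eqP->|/orP[] /eqP->].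
- by rewrite odd_intr // s_odd.
- by rewrite odd_oppZ // odd_intr // s_odd.
- by rewrite r6 eqxx !orbT.
- by rewrite r2 eqxx !orbT.
- by rewrite rN2 eqxx !orbT.
Qed.

End Wilson.

Lemma exceptional_8_unstable n (S : {set 'Z_n}) : exceptional_8 S -> unstable (cay S).
Proof.
case=> nE; move: S; rewrite nE => S SE.
(* This exchanges the cover edges joining 0 to 4 and 6 to 2 from layer [true] to layer [false]; the
   odd labels do not distinguish even vertices of a layer. *)
pose phi (i : bool) (x : 'Z_8) : 'Z_8 :=
  if i then tperm 0 6 x else tperm 2 4 x.
apply: (@twofold_unstable _ _ phi 0).
  split=> [[] x y /perm_inj //|i x y].
  rewrite /cay /= SE !inE; case: i => /=; rewrite !permE /=.
    by case: x => [[|[|[|[|[|[|[|[|//]]]]]]]] ix];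
       case: y => [[|[|[|[|[|[|[|[|//]]]]]]]] iy].
  by case: x => [[|[|[|[|[|[|[|[|//]]]]]]]] ix];
     case: y => [[|[|[|[|[|[|[|[|//]]]]]]]] iy].
by rewrite /phi !permE.
Qed.

Lemma even_group_set : group_set [set x : 'Z_8 | ~~ odd x].
Proof.
apply/group_setP; split=> [|x y]; rewrite !inE // => x_even y_even.
by rewrite (@odd_addZ 8) // (negPf x_even) (negPf y_even).
Qed.

Lemma exceptional_8_C3' n (S : {set 'Z_n}) : exceptional_8 S -> wilson_C3' S.
Proof.
case=> nE; move: S; rewrite nE => S SE; split=> //.
(* Translating an odd label by even residues stays in S, whereas 4 + H contains 0; so R = {4} and d
   = 4, and 2 lies in H but not in 4Z_8. *)
pose H := Group even_group_set; exists H.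
have SP (x : 'Z_8) : (x \in S) = (nat_of_ord x \in [:: 1; 3; 4; 5; 7]%N).
  by rewrite SE !inE; case: x => [[|[|[|[|[|[|[|[|//]]]]]]]] ix].
have RE : [set s in S | ~~ (translate s H \subset S)] = [set 4].
  apply/setP => s; rewrite !inE; have [->|s4] := eqVneq s 4.
    rewrite SP /=; apply/subsetPn; exists 0; last by rewrite SP.
    by apply/imsetP; exists 4; [rewrite inE|apply/val_inj].
  apply/andP => -[sS /subsetPn[_ /imsetP[x + ->]]].
  rewrite inE SP; move: sS s4; rewrite SP.
  by case: s => [[|[|[|[|[|[|[|[|//]]]]]]]] ?]; case: x => [[|[|[|[|[|[|[|[|//]]]]]]]] ?].
have dE : gcd_with_n [set 4 : 'Z_8] = 4%N by rewrite /gcd_with_n big_set1.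
rewrite /= RE dE; split=> //.
- by apply/set0Pn; exists 4; rewrite inE.
- by move=> r; rewrite inE => /eqP->.
left; apply/subsetPn; exists 2; rewrite ?inE //.
by apply/imsetP => -[x _]; case: x => [[|[|[|[|[|[|[|[|//]]]]]]]] ?].
Qed.

(** Finiteness makes the property decidable, which permits a case distinction without excluded
    middle. *)
Lemma graph_bipartiteP (T : finType) (e : rel T) :
  reflect (graph_bipartite e)
    [exists c : {ffun T -> bool}, [forall x, forall y, e x y ==> (c x != c y)]].
Proof.
apply: (iffP existsP) => -[c cP].
  by exists c => x y exy; have /forallP/(_ x)/forallP/(_ y)/implyP := cP; apply.
exists [ffun x => c x]; apply/forallP => x; apply/forallP => y.
by apply/implyP => /cP; rewrite !ffunE.
Qed.

Lemma graph_connectedP (T : finType) (e : rel T) :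
  reflect (graph_connected e) [forall x, forall y, connect e x y].
Proof.
apply: (iffP forallP) => [conn x y|conn x]; first by have /forallP := conn x.
exact/forallP.
Qed.

(** * The shape of S, and the classification *)

Section Pairs.
Variables (n : nat) (S : {set 'Z_n}).
Hypotheses (n_gt1 : (1 < n)%N) (S_no0 : 0 \notin S).
Hypothesis S_sym : S = [set - x | x in S].

Lemma mem_oppS x : (- x \in S) = (x \in S).
Proof. by rewrite {1}S_sym (mem_imset _ _ oppr_inj). Qed.

Lemma cay_sym : symmetric (cay S).
Proof. by move=> x y; rewrite /cay /= -mem_oppS opprB. Qed.

Lemma val_oppZ (x : 'Z_n) : x != 0 -> (- x)%R = (n - x)%N :> nat.
Proof.
rewrite -val_eqE /= -lt0n; have := ltn_Zn n_gt1 x.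
move: (x : nat) => {}x x_lt x_gt0; rewrite (Zp_cast n_gt1).
by rewrite modn_small //; lia.
Qed.

(* The elements below and above n/2 are exchanged by negation, so the odd     *)
(* cardinality forces n/2 itself to be a well-defined element of S.           *)
Lemma valency5_spans : #|S| = 5%N -> exists m (a b : 'Z_n),
  [/\ n = m.*2, spans m S a b, (0 < a)%N, (a < b)%N & (b < m)%N].
Proof.
move=> S5; have S_neq0 x : x \in S -> x != 0.
  by move=> xS; apply: contraNneq S_no0 => <-.
pose A := [set x in S | (x.*2 < n)%N]; pose B := [set x in S | (n < x.*2)%N].
pose F := [set x in S | x.*2 == n].
have cardB : #|B| = #|A|.
  have -> : B = [set - x | x in A]; last exact: card_imset oppr_inj.
  apply/setP => x; rewrite -[x in RHS]opprK (mem_imset _ _ oppr_inj) !inE mem_oppS.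
  have [xS|//] := boolP (x \in S); rewrite !andTb val_oppZ ?S_neq0 //.
  have := ltn_Zn n_gt1 x; lia.
have cardF : (#|F| <= 1)%N.
  apply/card_le1_eqP => x y; rewrite !inE => /andP[_ /eqP xn] /andP[_ /eqP yn].
  by apply/val_inj/double_inj; rewrite /= xn yn.
have ABF : (#|A| + #|B| + #|F| = 5)%N.
  rewrite -S5 -(cardsID [set x : 'Z_n | (x.*2 < n)%N] S).
  rewrite -(cardsID [set x : 'Z_n | (n < x.*2)%N] (S :\: _)) addnA.
  congr (_ + _ + _)%N; apply: eq_card => x; rewrite !inE //.
    by case: (x \in S) => //=; rewrite -?leqNgt ?andbT ?andbF //; lia.
  by case: (x \in S); rewrite ?andbF // ?andbT /=; lia.
have /cards1P[f FE] : #|F| == 1%N by lia.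
have /cards2P[a [b [neq_ab AE]]] : #|A| == 2%N by lia.
have fF : f \in F by rewrite FE inE.
have nE : n = (f : nat).*2 by move: fF; rewrite inE => /andP[_ /eqP].
pose m := nat_of_ord f; rewrite -/m in nE.
have hE : m%:R = f :> 'Z_n by rewrite natr_Zp.
wlog ltab : a b neq_ab AE / (a < b)%N => [hw|].
  have [lt|gt|/val_inj eq_ab] := ltngtP (a : nat) b; first exact: (hw a b).
    by apply: (hw b a) => //; rewrite ?(eq_sym b) // AE setUC.
  by rewrite eq_ab eqxx in neq_ab.
have aA : a \in A by rewrite AE !inE eqxx.
have bA : b \in A by rewrite AE !inE eqxx orbT.
have AP x : x \in S -> (x.*2 < n)%N -> x \in [:: a; b].
  move=> xS x_lt; have : x \in A by rewrite inE xS.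
  by rewrite AE !inE.
have Sab : S =i [:: a; - a; b; - b; m%:R].
  move=> x; apply/idP/idP => [xS|]; last first.
    move: aA bA fF; rewrite !inE => /andP[aS _] /andP[bS _] /andP[fS _].
    by do 4?[case/predU1P=> [->|]] => [||||/eqP->]; rewrite ?mem_oppS ?hE.
  have [lt|gt|eq] := ltngtP (x.*2) n.
  - by have := AP x xS lt; rewrite !inE => /orP[] ->; rewrite ?orbT.
  - have : - x \in [:: a; b].
      apply: AP; rewrite ?mem_oppS // val_oppZ ?S_neq0 //.
      by have := ltn_Zn n_gt1 x; lia.
    by rewrite !inE !(eqr_oppLR x) => /orP[] ->; rewrite ?orbT.
  - have : x \in F by rewrite inE xS eq eqxx.
    by rewrite FE hE !inE => ->; rewrite !orbT.
exists m, a, b; split=> //.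
- by split=> //; apply/card_uniqP; rewrite -(eq_card Sab) S5.
- by move: aA; rewrite inE lt0n => /andP[/S_neq0].
- by move: bA; rewrite inE => /andP[_]; rewrite [X in (_ < X)%N]nE ltn_double.
Qed.

End Pairs.

(** Since m = 3a is even, a = 2k is even and connectedness makes s = b odd; then m = 6k and n =
    12k. *)
Lemma triple_half_family n m (S : {set 'Z_n}) (a b : 'Z_n) :
  (1 < n)%N -> n = m.*2 -> graph_connected (cay S) -> spans m S a b ->
  (a < m)%N -> ~~ odd m -> a *+ 3 = m%:R -> family_12k S.
Proof.
move=> n_gt1 nE conn ab lt_am m_even a3.
have a3E : (3 * a)%N = m by apply/eqP; rewrite -(triple_half n_gt1 nE) // a3.
have a_even : ~~ odd a by move: m_even; rewrite -a3E oddM.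
have b_odd : odd b.
  by have := parity_connected n_gt1 nE conn ab m_even; rewrite (negPf a_even).
have [Sab _] := ab; pose k := (a : nat)./2.
have aE : (2 * k)%N = a by rewrite mul2n halfK (negPf a_even) subn0.
exists k, (b : nat); split.
- by move: lt_am aE a3E; lia.
- by rewrite dvdzE dvdn2 negbK.
- by rewrite [LHS]nE -a3E -aE; lia.
apply/setP => x; rewrite Sab !inE -pmulrn !natr_Zp aE natr_Zp.
have -> : (6 * k)%N = m by rewrite -a3E -aE; lia.
by rewrite -!orbA; do 4?[case: eqP => //=].
Qed.

(** Moves a vertex where the two permutations differ to 0 and makes [phi false] fix 0. *)
Lemma translate_twofold n (S : {set 'Z_n}) phi v :
  twofold (cay S) phi ->
  twofold (cay S) (fun i x => phi i (x + v) - phi false v).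
Proof.
move=> [inj adj]; split=> [i x y /addIr/inj/addIr //|i x y].
have := adj i (x + v) (y + v); rewrite /cay /= => adjE.
have -> : y - x = y + v - (x + v) by ring.
by rewrite -adjE; congr (_ \in S); ring.
Qed.

Theorem theorem5p1 (n : nat) (S : {set 'Z_n})
    (n_gt1 : (1 < n)%N)
    (S_no0 : 0 \notin S)
    (S_sym : S = [set - x | x in S])
    (valency5 : #|S| = 5%N) :
  [/\ unstable (cay S) <->
        trivially_unstable (cay S) \/ (family_12k S \/ exceptional_8 S),
      family_12k S -> wilson_C1 S
    & exceptional_8 S -> wilson_C3' S].
Proof.
split; [|exact: family_12k_C1|exact: exceptional_8_C3'].
split=> [unst|[[]//|[/(family_12k_C1 n_gt1)|/exceptional_8_unstable //]]]; last first.
  exact: wilson_C1_unstable.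
have [conn|nconn] := graph_connectedP (cay S); last by left; split=> // -[].
have [bip|nbip] := graph_bipartiteP (cay S); first by left; split=> // -[].
right; have [m [a [b [nE ab a_gt0 ltab ltbm]]]] :=
  valency5_spans n_gt1 S_no0 S_sym valency5.
have [phi [phi_tf [v neq_v]]] := unstable_twofold conn nbip (cay_sym S_sym) unst.
have psi_tf := translate_twofold v phi_tf.
have [|/eqP|[m_even [a3|b3]]|[m4 a1 b3]] :=
  stable_or_exceptional n_gt1 nE conn nbip psi_tf _ ab a_gt0 ltab ltbm.
- by rewrite add0r subrr.
- by rewrite add0r subr_eq0 eq_sym => /eqP.
- by left; apply: (triple_half_family n_gt1 nE conn ab) => //; apply: ltn_trans ltbm.
- by left; apply: (triple_half_family n_gt1 nE conn (spans_swap ab)).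
right; have n8 : n = 8%N by rewrite nE m4.
split=> //; have [Sab _] := ab; apply/setP => x.
have aE : a = 1 by rewrite -[a]natr_Zp a1.
have bE : b = 3%:R by rewrite -[b]natr_Zp b3.
by rewrite Sab aE bE m4 !inE -!orbA.
Qed.
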